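(* Let $q\ge 4$ be a power of $2$, and let $\pi:\mathbb{F}_q^2\to\mathbb{F}_q^2$ be the map $\pi(x_1,x_2)=(x_1+x_2,\,x_1x_2)$. The images under $\pi$ of the distinguished points of $\mathbb{F}_q^2$ form the set $\Delta=\bar{\Delta}\setminus\{(0,0)\}$, where $$\bar{\Delta}=\{(y_1,ay_1^2): y_1\in\mathbb{F}_q,\ a\in\mathbb{F}_q,\ \mathfrak{Tr}(a)=0\}.$$
   Context: A distinguished point of $\mathbb{F}_q^2$ is a point $(x_1,x_2)$ with $x_1\ne x_2$. For $q=2^h$, $\mathfrak{Tr}(x)=x+x^2+x^4+\dots+x^{2^{h-1}}$ is the trace of $x\in\mathbb{F}_q$. *)

(* Defs.v *)
From mathcomp Require Import all_boot all_algebra.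

Set Implicit Arguments.
Unset Strict Implicit.
Unset Printing Implicit Defensive.

Import GRing.Theory.
Local Open Scope ring_scope.

(* The absolute trace x + x^2 + x^4 + ... + x^(2^(h-1)); it is the trace of
   F_q over F_2 only when #|F| = 2 ^ h. *)
Definition abs_trace (F : finFieldType) (h : nat) (x : F) : F :=
  \sum_(i < h) x ^+ (2 ^ i).

Definition distinguished (F : finFieldType) : {set F * F} :=
  [set x | x.1 != x.2].

Definition pi_map (F : finFieldType) (x : F * F) : F * F :=
  (x.1 + x.2, x.1 * x.2).

Definition Delta_bar (F : finFieldType) (h : nat) : {set F * F} :=
  [set (y1, a * y1 ^+ 2) | y1 in F, a in F & abs_trace h a == 0].

Definition Delta (F : finFieldType) (h : nat) : {set F * F} :=
  Delta_bar F h :\ (0, 0).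

(* Main.v *)
Require Import Defs.
From mathcomp Require Import all_boot all_algebra.
From mathcomp Require Import finfield ring.

Set Implicit Arguments.
Unset Strict Implicit.
Unset Printing Implicit Defensive.

Import GRing.Theory.
Local Open Scope ring_scope.

(** A pair [(y1, y2)] is the image of a distinguished point exactly when the
    quadratic [X^2 + y1 X + y2] splits into two distinct roots.  In
    characteristic 2 the roots [x1], [x2] are distinct if and only if their sum
    [y1] is nonzero, and then the substitution [X = y1 t] turns the equation
    into the Artin-Schreier equation [t^2 + t = y2 / y1^2], whose two solutions
    are [t] and [t + 1].  So the claim reduces to the additive form of
    Hilbert's Theorem 90 over the field with two elements: [a] has the form
    [t^2 + t] if and only if its absolute trace vanishes ([artin_schreier_image]).
    The condition [y1 != 0] corresponds to the removal of [(0, 0)], because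
    [(y1, a y1^2)] is the origin if and only if [y1 = 0].

    Hilbert 90 is obtained by counting.  The trace of [t^2 + t] telescopes to
    [t^q + t = 0], so the image of the Artin-Schreier map lies in the kernel of
    the trace.  That map is at most two-to-one, so its image has at least [q/2]
    elements; the kernel consists of roots of a polynomial of degree [q/2], so
    it has at most [q/2] elements.  The two sets therefore coincide. *)

Section CharacteristicTwo.

Variables (F : finFieldType) (charF : 2 \in [pchar F]).

Lemma addr_eq0_pchar2 (x y : F) : (x + y == 0) = (x == y).
Proof. by rewrite -{1}[y](oppr_pchar2 charF) subr_eq0. Qed.

(** Each term [t^(2^i)] occurs twice, as the square of its predecessor and in
    its own right, except for the two extreme ones. *)
Lemma abs_trace_artin_schreier h (t : F) :
  abs_trace h (t ^+ 2 + t) = t ^+ (2 ^ h) + t.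
Proof.
rewrite /abs_trace; elim: h => [|h IHh].
  by rewrite big_ord0 expr1 addrr_pchar2.
rewrite big_ord_recr /= IHh exprDn_pchar; last by rewrite pnatX pnatE ?charF.
rewrite -exprM -expnS addrC -addrA [_ ^+ (2 ^ h) + (_ + _)]addrA.
by rewrite addrr_pchar2 // add0r.
Qed.

(** If [s^2 + s = t^2 + t] then [(s + t) (s + t + 1) = 0]. *)
Lemma artin_schreier_eq (s t : F) :
  s ^+ 2 + s = t ^+ 2 + t -> s \in [set t; t + 1].
Proof.
move=> eq_st; have : (s - t) * (s - (- t - 1)) == 0.
  have -> : (s - t) * (s - (- t - 1)) = s ^+ 2 + s - (t ^+ 2 + t) by ring.
  by rewrite eq_st subrr.
by rewrite mulf_eq0 !subr_eq0 !(oppr_pchar2 charF) !inE.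
Qed.

Lemma card_artin_schreier_image :
  (#|F| <= 2 * #|[set (t ^+ 2 + t)%R | t in F]|)%N.
Proof.
rewrite -[leqLHS]sum1_card.
rewrite (partition_big_imset (fun t : F => t ^+ 2 + t)) /=.
rewrite mulnC -sum_nat_const; apply: leq_sum => _ /imsetP[t _ ->].
rewrite sum1_card (@leq_trans #|[set t; t + 1]|) //; last first.
  by rewrite cards2; case: (_ != _).
apply/subset_leq_card/subsetP => s; rewrite inE => /eqP.
by move/artin_schreier_eq; rewrite !inE.
Qed.

End CharacteristicTwo.

Lemma size_trace_poly (R : nzRingType) h :
  size (\sum_(i < h.+1) 'X^(2 ^ i) : {poly R}) = (2 ^ h).+1.
Proof.
elim: h => [|h IHh]; first by rewrite big_ord1 size_polyXn.
by rewrite big_ord_recr /= addrC size_polyDl size_polyXn // IHh ltnS ltn_exp2l.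
Qed.

Lemma card_abs_trace_kernel (F : finFieldType) h :
  (#|[set a : F | abs_trace h.+1 a == 0%R]| <= 2 ^ h)%N.
Proof.
rewrite cardE -ltnS -(size_trace_poly F h) max_poly_roots ?enum_uniq //.
  by rewrite -size_poly_eq0 size_trace_poly.
apply/allP => a; rewrite mem_enum inE /root horner_sum => /eqP tr_a0.
by apply/eqP; rewrite -[RHS]tr_a0; apply: eq_bigr => i _; rewrite hornerXn.
Qed.

(** Additive Hilbert 90: one inclusion is the telescoping of the trace, and the
    two cardinality bounds [q/2] turn it into an equality. *)
Lemma artin_schreier_image (F : finFieldType) h :
    #|F| = (2 ^ h)%N ->
  [set t ^+ 2 + t | t in F] = [set a : F | abs_trace h a == 0].
Proof.
move=> cardF; have charF := card_finPcharP cardF isT.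
case: h cardF => [|h] cardF.
  by have := finNzRing_gt1 F; rewrite cardF.
apply/eqP; rewrite eqEcard; apply/andP; split.
  apply/subsetP => _ /imsetP[t _ ->].
  by rewrite inE abs_trace_artin_schreier // -cardF expf_card addrr_pchar2.
apply: leq_trans (card_abs_trace_kernel F h) _.
rewrite -(leq_pmul2l (ltn0Sn 1)) -expnS -cardF.
exact: card_artin_schreier_image.
Qed.

Theorem lemma2 (q h : nat) (hq : q = (2 ^ h)%N) (q_ge4 : (4 <= q)%N)
    (F : finFieldType) (cardF : #|F| = q) :
  @pi_map F @: distinguished F = Delta F h.
Proof.
rewrite hq in cardF; have charF := card_finPcharP cardF isT.
have trace0E (a : F) : (abs_trace h a == 0) = (a \in [set t ^+ 2 + t | t in F]).
  by rewrite (artin_schreier_image cardF) inE.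
apply/setP => y; apply/imsetP/setD1P => [[[x1 x2]] | [y_neq0]].
  rewrite inE /pi_map /= -(addr_eq0_pchar2 charF) => y1_neq0 ->; split.
    by apply: contraNneq y1_neq0 => -[->].
  (* The root [x1 = y1 t] gives [t = x1 / y1] and [a = x1 x2 / y1^2]. *)
  pose t := x1 / (x1 + x2).
  apply/imset2P; exists (x1 + x2) (t ^+ 2 + t) => //.
    by rewrite inE trace0E; apply: (imset_f (fun t : F => t ^+ 2 + t)).
  congr pair; rewrite mulrDl -exprMn /t divfK // expr2 [_ * _ ^+ 2]mulrA divfK //.
  by rewrite mulrDr addrA addrr_pchar2 // add0r.
case/imset2P => y1 a _; rewrite inE trace0E => /imsetP[t _ ->] y_def.
have y1_neq0 : y1 != 0.
  by apply: contra_neq y_neq0 => y1_0; rewrite y_def y1_0 expr0n mulr0.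
exists (y1 * t, y1 * (t + 1)).
  rewrite inE /= -(addr_eq0_pchar2 charF) mulrDr addrA addrr_pchar2 // add0r.
  by rewrite mulr1.
rewrite y_def /pi_map /=; congr pair; last by ring.
by rewrite mulrDr addrA addrr_pchar2 // add0r mulr1.
Qed.
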